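(* There exists a bijection between the set of optimal solutions of the bi-level problem (B) and the set of optimal solutions of problem (G), where (G) and (B) are the following. Problem (G): minimize $$\sum_{i=0}^{N-1}\frac{\Delta s_i}{\dot s_i}$$ over $t=(t_0,\dots,t_{N-1})\in\mathbb{R}_+^{N}$, $\dot s=(\dot s_0,\dots,\dot s_N)\in\mathbb{R}_+^{N+1}$, $\ddot s=(\ddot s_0,\dots,\ddot s_{N-1})\in\mathbb{R}^{N}$, $\theta=(\theta_1,\dots,\theta_n)\in\mathbb{R}^{nd}$, subject to, for all $j=1,\dots,n$, - $E(\theta)\le\epsilon$; - $\underline q_j\le p_i\theta_j\le\overline q_j$ for $i=0,\dots,N$; - $\dot{\underline q}_j\le p_i'\theta_j\,\dot s_i\le\dot{\overline q}_j$ for $i=0,\dots,N$; - $\ddot{\underline q}_j\le p_i''\theta_j\,\dot s_i^2+p_i'\theta_j\,\ddot s_i\le\ddot{\overline q}_j$ for $i=0,\dots,N-1$; - $\dot s_{i+1}=\dot s_i+\ddot s_i t_i$ for $i=0,\dots,N-1$; - $s_{i+1}=s_i+\dot s_i t_i+\ddot s_i\,t_i^2/2$ for $i=0,\dots,N-1$. Problem (B): minimize $V(\theta)$ over $\theta\in\mathbb{R}^{nd}$ subject to $E(\theta)\le\epsilon$ and $\underline q_j\le p_i\theta_j\le\overline q_j$ for all $i=0,\dots,N$, $j=1,\dots,n$, where $V(\theta)$ is the value of the lower-level problem $$V(\theta)=\min_{\dot s_0^2,\dots,\dot s_N^2\ge 0}\left(\sum_{i=0}^{N-1}\frac{\Delta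 s_i}{\sqrt{\dot s_i^2}}\right)^2$$ subject to $-\dot{\underline q}_j^2\le\operatorname{sign}(p_i'\theta_j)(p_i'\theta_j)^2\dot s_i^2\le\dot{\overline q}_j^2$ for $i=0,\dots,N$, $j=1,\dots,n$, and $\ddot{\underline q}_j\le\left(p_i''\theta_j-\frac{p_i'\theta_j}{2\Delta s_i}\right)\dot s_i^2+\frac{p_i'\theta_j}{2\Delta s_i}\dot s_{i+1}^2\le\ddot{\overline q}_j$ for $i=0,\dots,N-1$, $j=1,\dots,n$.
   Context: $N,n,m,d$ are positive integers, $n>m$. $0=s_0<s_1<\dots<s_N=1$ are path points, $\Delta s_i=s_{i+1}-s_i>0$. The function $p:\mathbb{R}\to\mathbb{R}^{1\times d}$ is a twice differentiable row-vector basis; $p_i=p(s_i)$, $p_i'=p'(s_i)$, $p_i''=p''(s_i)$. For $\theta=(\theta_1,\dots,\theta_n)$ with $\theta_j\in\mathbb{R}^d$, the joint configuration at $s_i$ is $q_i=(I_n\otimes p_i)\theta=(p_i\theta_1,\dots,p_i\theta_n)\in\mathbb{R}^n$. The forward kinematics is a map $k:\mathbb{R}^n\to\mathbb{R}^m$, the desired path points are $\chi_i^d\in\mathbb{R}^m$, and $E(\theta)=\left(\sum_{i=0}^N\|\chi_i^d-k((I_n\otimes p_i)\theta)\|_2^{r}\right)^{1/r}$ for a fixed exponent $r\ge1$; $\epsilon$ is a given tolerance. For each joint $j$, $\underline q_j,\overline q_j$ are position limits, $\dot{\underline q}_j<0<\dot{\overline q}_j$ velocity limits, and $\ddot{\underline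 q}_j<0<\ddot{\overline q}_j$ acceleration limits. $\operatorname{sign}(0)=0$. Here $\mathbb{R}_+$ denotes nonnegative reals, and the objectives are $+\infty$ when some $\dot s_i=0$, $0\le i\le N-1$. In (B), the lower-level decision variables are the squared speeds $\dot s_i^2$; $\dot s_i\ge 0$ is identified with its square. An optimal solution of (B) is a pair $(\dot s,\theta)$ such that $\theta$ is optimal for the upper-level problem and $(\dot s_i^2)_{i=0}^N$ attains the minimum in the lower-level problem defining $V(\theta)$. *)

(* Defs.v *)
From mathcomp Require Export all_boot all_order all_algebra.
From mathcomp Require Export all_classical all_reals all_analysis.

Set Implicit Arguments.
Unset Strict Implicit.
Unset Printing Implicit Defensive.

Import Order.TTheory GRing.Theory Num.Theory.
Import numFieldNormedType.Exports.

Local Open Scope classical_set_scope.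
Local Open Scope ring_scope.

Definition norm2 (R : realType) (m : nat) (u : 'rV[R]_m) : R :=
  Num.sqrt (\sum_l u 0 l ^+ 2).

Definition minimizers (R : realType) (T : Type) (S : set T) (f : T -> \bar R) :
    set T :=
  [set x | S x /\ forall y, S y -> (f x <= f y)%E].

Record path_data (R : realType) (N n m d : nat) := PathData {
  s : 'I_N.+1 -> R;
  p : R -> 'rV[R]_d;
  k : 'rV[R]_n -> 'rV[R]_m;
  chi : 'I_N.+1 -> 'rV[R]_m;
  r : R;
  eps : R;
  qmin : 'I_n -> R;
  qmax : 'I_n -> R;
  vmin : 'I_n -> R;
  vmax : 'I_n -> R;
  amin : 'I_n -> R;
  amax : 'I_n -> R
}.

Section Problems.
Context {R : realType} {N n m d : nat} (D : path_data R N n m d).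

(* For i < N, [lo i] and [hi i] are i and i + 1 as indices in {0, ..., N}. *)
Definition lo (i : 'I_N) : 'I_N.+1 := widen_ord (leqnSn N) i.
Definition hi (i : 'I_N) : 'I_N.+1 := lift ord0 i.

Definition ds (i : 'I_N) : R := s D (hi i) - s D (lo i).

(* theta = (theta_1, ..., theta_n) is the matrix whose columns are the theta_j,
   so that the row p_i *m theta is (p_i theta_1, ..., p_i theta_n), which is
   the vector (I_n (x) p_i) theta. *)
Definition q (theta : 'M[R]_(d, n)) (i : 'I_N.+1) : 'rV[R]_n :=
  p D (s D i) *m theta.
Definition q1 (theta : 'M[R]_(d, n)) (i : 'I_N.+1) : 'rV[R]_n :=
  derive1 (p D) (s D i) *m theta.
Definition q2 (theta : 'M[R]_(d, n)) (i : 'I_N.+1) : 'rV[R]_n :=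
  derive1 (derive1 (p D)) (s D i) *m theta.

Definition E (theta : 'M[R]_(d, n)) : R :=
  (\sum_(i < N.+1) norm2 (chi D i - k D (q theta i)) `^ r D) `^ (r D)^-1.

Definition path_feasible : set 'M[R]_(d, n) :=
  [set theta | E theta <= eps D /\
    forall i j, qmin D j <= q theta i 0 j <= qmax D j].

(* The variables of (G) are (t, v, a, theta), where v_i and a_i are the path
   speeds and path accelerations. *)
Definition G_var : Type :=
  ('rV[R]_N * 'rV[R]_N.+1 * 'rV[R]_N * 'M[R]_(d, n))%type.

Definition G_feasible : set G_var :=
  [set z : G_var | let: (t, v, a, theta) := z in
    [/\ forall i, 0 <= t 0 i,
        forall i, 0 <= v 0 i
      & path_feasible theta] /\
    [/\ forall i j, vmin D j <= q1 theta i 0 j * v 0 i <= vmax D j,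
        forall (i : 'I_N) j,
          amin D j <= q2 theta (lo i) 0 j * v 0 (lo i) ^+ 2
                      + q1 theta (lo i) 0 j * a 0 i <= amax D j,
        forall i : 'I_N, v 0 (hi i) = v 0 (lo i) + a 0 i * t 0 i
      & forall i : 'I_N, s D (hi i) =
          s D (lo i) + v 0 (lo i) * t 0 i + a 0 i * t 0 i ^+ 2 / 2]].

(* Division by zero yields 0 in a field: the value +oo at vanishing speeds has
   to be imposed. The last speed does not enter the objective. *)
Definition G_objective (z : G_var) : \bar R :=
  let: (_, v, _, _) := z in
  if [exists i : 'I_N, v 0 (lo i) == 0] then +oo%E
  else (\sum_(i < N) ds i / v 0 (lo i))%:E.

Definition G_optimal : set G_var := minimizers G_feasible G_objective.

(* In the lower-level problem, x_i stands for the squared path speed. *)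
Definition lower_feasible (theta : 'M[R]_(d, n)) : set 'rV[R]_N.+1 :=
  [set x | [/\ forall i, 0 <= x 0 i,
    forall i j,
      - vmin D j ^+ 2
        <= Num.sg (q1 theta i 0 j) * q1 theta i 0 j ^+ 2 * x 0 i
        <= vmax D j ^+ 2
  & forall (i : 'I_N) j,
      amin D j
        <= (q2 theta (lo i) 0 j - q1 theta (lo i) 0 j / (2 * ds i))
             * x 0 (lo i)
           + q1 theta (lo i) 0 j / (2 * ds i) * x 0 (hi i)
        <= amax D j]].

Definition lower_objective (x : 'rV[R]_N.+1) : \bar R :=
  if [exists i : 'I_N, x 0 (lo i) == 0] then +oo%E
  else ((\sum_(i < N) ds i / Num.sqrt (x 0 (lo i))) ^+ 2)%:E.

(* The value is an infimum: it is not attained when the constraints leave the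
   speeds unbounded, for instance when all q1 and q2 vanish. *)
Definition V (theta : 'M[R]_(d, n)) : \bar R :=
  ereal_inf [set lower_objective x | x in lower_feasible theta].

Definition B_var : Type := ('rV[R]_N.+1 * 'M[R]_(d, n))%type.

Definition B_optimal : set B_var :=
  [set y : B_var | let: (v, theta) := y in
    [/\ minimizers path_feasible V theta,
        forall i, 0 <= v 0 i
      & minimizers (lower_feasible theta) lower_objective
          (\row_i v 0 i ^+ 2)]].

End Problems.

(* Main.v *)
(* When the speeds at the path points other than the last one are positive, a
   uniformly accelerated motion from speed v to speed v' over a distance l has
   duration 2 l / (v + v') and acceleration (v'^2 - v^2) / (2 l). So (t, a) in
   (G) is a function of the speeds, and substituting it turns the constraints
   of (G) into those of (B). Slow constant speeds are always admissible, so
   optimal solutions of either problem have a finite cost, hence positive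
   speeds. Both sets of optimal solutions are thus the minimizers of the
   traversal time over the pairs (speeds, theta). *)
Require Import Defs.
From mathcomp Require Import ring.

Set Implicit Arguments.
Unset Strict Implicit.
Unset Printing Implicit Defensive.

Import Order.TTheory GRing.Theory Num.Theory.
Import numFieldNormedType.Exports.
Local Open Scope classical_set_scope.
Local Open Scope ring_scope.

(** * Scalar kinematics and interval constraints *)

Lemma uniform_acceleration (R : realFieldType) (x x' v v' a t : R) :
    0 < x' - x -> 0 < v -> 0 <= v' ->
  (v' = v + a * t /\ x' = x + v * t + a * t ^+ 2 / 2) <->
  (t = 2 * (x' - x) / (v + v') /\
   a = (v' ^+ 2 - v ^+ 2) / (2 * (x' - x))).
Proof.
move=> l_gt0 v_gt0 v'_ge0.
(* Positivity of the initial speed suffices, so [v'] may vanish, as the last path speed can. *)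
have vv'_neq0 : v + v' != 0 by rewrite gt_eqF// ltr_pwDl.
have l_neq0 : x' - x != 0 by rewrite gt_eqF.
split=> [[Ev' Ex']|[-> ->]]; last by split; field; rewrite ?vv'_neq0 ?l_neq0.
(* Distance is mean speed times duration; multiplying by [a] then gives the difference of the
   squared speeds. *)
have El : t * (v + v') = 2 * (x' - x) by rewrite Ex' Ev'; field.
split; first by rewrite -El mulfK.
apply: (mulIf (_ : 2 * (x' - x) != 0)); first by rewrite mulf_neq0.
rewrite divfK ?mulf_neq0// -El Ev'; ring.
Qed.

(** The signed square is increasing. Since [a < 0 < b], the sign of [w] makes one of the two bounds
    automatic, and the other compares squares of numbers of the same sign. *)
Lemma signed_sqr_itv (R : realDomainType) (a b w v : R) :
    a < 0 -> 0 < b -> 0 <= v ->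
  (- a ^+ 2 <= Num.sg w * w ^+ 2 * v ^+ 2 <= b ^+ 2) = (a <= w * v <= b).
Proof.
move=> a_lt0 b_gt0 v_ge0.
rewrite -mulrA -exprMn.
have [w_lt0|w_gt0|->] := ltgtP w 0; last first.
- by rewrite sgr0 !mul0r oppr_le0 !sqr_ge0 (ltW a_lt0) (ltW b_gt0).
- rewrite gtr0_sg// mul1r.
  have wv_ge0 : 0 <= w * v by rewrite mulr_ge0// ltW.
  rewrite (le_trans (ltW a_lt0) wv_ge0) (le_trans _ (sqr_ge0 _)) ?oppr_le0 ?sqr_ge0//=.
  by rewrite ler_sqr ?nnegrE// ltW.
- rewrite ltr0_sg// mulN1r lerN2.
  have wv_le0 : w * v <= 0 by rewrite mulr_le0_ge0// ltW.
  rewrite (le_trans wv_le0 (ltW b_gt0)) (le_trans _ (sqr_ge0 b)) ?oppr_le0 ?sqr_ge0//.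
  rewrite !andbT -(sqrrN (w * v)) -(sqrrN a) ler_sqr ?nnegrE ?oppr_ge0 ?lerN2//.
  exact: ltW.
Qed.

Lemma near0_mul_itv (R : realType) (a b w : R) : a < 0 < b ->
  \forall x \near 0^'+, a <= w * x <= b.
Proof.
move=> /andP[a_lt0 b_gt0].
have cvg0 : w * x @[x --> (0 : R)^'+] --> (0 : R).
  apply: cvg_at_right_filter; rewrite -[X in _ --> X](mulr0 w).
  by apply: cvgM; [exact: cvg_cst|exact: cvg_id].
near=> x; apply/andP; split; near: x.
- exact: (cvgr_ge _ cvg0).
- exact: (cvgr_le _ cvg0).
Unshelve. all: by end_near. Qed.

(** * Speed profiles and the motions they determine *)

Section SpeedProfiles.
Context {R : realType} {N n m d : nat} (D : path_data R N n m d).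
Hypothesis ds_gt0 : forall i, 0 < ds D i.
Hypothesis v_limits : forall j, vmin D j < 0 < vmax D j.
Hypothesis a_limits : forall j, amin D j < 0 < amax D j.

Definition squared_speeds (v : 'rV[R]_N.+1) : 'rV[R]_N.+1 :=
  \row_i v 0 i ^+ 2.

Lemma squared_speedsE (v : 'rV[R]_N.+1) i :
  squared_speeds v 0 i = v 0 i ^+ 2.
Proof. by rewrite mxE. Qed.

Definition duration (v : 'rV[R]_N.+1) : R :=
  \sum_(i < N) ds D i / v 0 (lo i).

(** Common ground of (G) and (B): feasible pairs of finite cost, which can be compared by the real
    number [duration]. Positivity is asked only at the indices [lo i], because the last speed is
    absent from the cost. *)
Definition profile_feasible : set (@B_var R N n d) :=
  [set y : @B_var R N n d | let: (v, theta) := y in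
    [/\ path_feasible D theta, forall i, 0 <= v 0 i,
        forall i : 'I_N, 0 < v 0 (lo i)
      & lower_feasible D theta (squared_speeds v)]].

Definition profile_optimal : set (@B_var R N n d) :=
  [set y : @B_var R N n d | profile_feasible y /\
    forall y', profile_feasible y' -> duration y.1 <= duration y'.1].

Definition motion_of (y : @B_var R N n d) : @G_var R N n d :=
  let: (v, theta) := y in
  (\row_i (2 * ds D i / (v 0 (lo i) + v 0 (hi i))), v,
   \row_i ((v 0 (hi i) ^+ 2 - v 0 (lo i) ^+ 2) / (2 * ds D i)), theta).

Lemma duration_ge0 (v : 'rV[R]_N.+1) :
  (forall i, 0 <= v 0 i) -> 0 <= duration v.
Proof. by move=> v_ge0; apply: sumr_ge0 => i _; rewrite divr_ge0// ltW. Qed.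

(** The velocity bounds match by [signed_sqr_itv]; the acceleration bounds match by collecting the
    terms in each squared speed. *)
Lemma lower_feasible_squared (theta : 'M[R]_(d, n)) (v : 'rV[R]_N.+1) :
  (forall i, 0 <= v 0 i) ->
  lower_feasible D theta (squared_speeds v) <->
  (forall i j, vmin D j <= q1 D theta i 0 j * v 0 i <= vmax D j) /\
  (forall (i : 'I_N) j,
     amin D j <= q2 D theta (lo i) 0 j * v 0 (lo i) ^+ 2
       + q1 D theta (lo i) 0 j
         * ((v 0 (hi i) ^+ 2 - v 0 (lo i) ^+ 2) / (2 * ds D i)) <= amax D j).
Proof.
move=> v_ge0.
have Ev i j : (- vmin D j ^+ 2
    <= Num.sg (q1 D theta i 0 j) * q1 D theta i 0 j ^+ 2
         * squared_speeds v 0 i <= vmax D j ^+ 2)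
    = (vmin D j <= q1 D theta i 0 j * v 0 i <= vmax D j).
  by case/andP: (v_limits j) => ? ?; rewrite squared_speedsE signed_sqr_itv.
have Ea (i : 'I_N) j : (q2 D theta (lo i) 0 j
      - q1 D theta (lo i) 0 j / (2 * ds D i)) * squared_speeds v 0 (lo i)
    + q1 D theta (lo i) 0 j / (2 * ds D i) * squared_speeds v 0 (hi i)
    = q2 D theta (lo i) 0 j * v 0 (lo i) ^+ 2 + q1 D theta (lo i) 0 j
         * ((v 0 (hi i) ^+ 2 - v 0 (lo i) ^+ 2) / (2 * ds D i)).
  by rewrite !squared_speedsE; field; rewrite gt_eqF.
split=> [[_ Hv Ha]|[Hv Ha]].
- by split=> i j; rewrite -?Ev -?Ea.
- by split=> [i|i j|i j]; rewrite ?Ev ?Ea// squared_speedsE sqr_ge0.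
Qed.

Lemma G_feasible_motion_of (t a : 'rV[R]_N) (v : 'rV[R]_N.+1)
    (theta : 'M[R]_(d, n)) : (forall i : 'I_N, 0 < v 0 (lo i)) ->
  G_feasible D (t, v, a, theta) <->
  (t, v, a, theta) = motion_of (v, theta) /\ profile_feasible (v, theta).
Proof.
move=> v_gt0; split.
- move=> [[t_ge0 v_ge0 path_theta] [Hv Ha v_step s_step]].
  have ta i := (uniform_acceleration (a 0 i) (t 0 i) (ds_gt0 i)
    (v_gt0 i) (v_ge0 (hi i))).1 (conj (v_step i) (s_step i)).
  have Et : t = \row_i (2 * ds D i / (v 0 (lo i) + v 0 (hi i))).
    by apply/rowP => i; rewrite mxE; case: (ta i).
  have Ea : a = \row_i ((v 0 (hi i) ^+ 2 - v 0 (lo i) ^+ 2) / (2 * ds D i)).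
    by apply/rowP => i; rewrite mxE; case: (ta i).
  split; first by rewrite /motion_of -Et -Ea.
  split=> //; apply/lower_feasible_squared => //; split=> // i j.
  by have := Ha i j; rewrite (ta i).2.
- move=> [[-> ->] [path_theta v_ge0 _ /(lower_feasible_squared _ v_ge0)[Hv Ha]]].
  have ta (i : 'I_N) := (uniform_acceleration _ _
    (ds_gt0 i) (v_gt0 i) (v_ge0 (hi i))).2 (conj erefl erefl).
  split; split=> //.
  + by move=> i; rewrite mxE divr_ge0 ?addr_ge0 ?mulr_ge0// ltW.
  + by move=> i j; rewrite [X in _ + _ * X]mxE; exact: Ha.
  + by move=> i; rewrite !mxE; case: (ta i).
  + by move=> i; rewrite !mxE; case: (ta i).
Qed.

Lemma G_objective_duration (t a : 'rV[R]_N) (v : 'rV[R]_N.+1)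
    (theta : 'M[R]_(d, n)) : (forall i : 'I_N, 0 < v 0 (lo i)) ->
  G_objective D (t, v, a, theta) = (duration v)%:E.
Proof.
move=> v_gt0; rewrite /G_objective; case: ifPn => // /existsP[i].
by rewrite gt_eqF.
Qed.

Lemma lower_objective_duration (v : 'rV[R]_N.+1) :
  (forall i : 'I_N, 0 < v 0 (lo i)) ->
  lower_objective D (squared_speeds v) = (duration v ^+ 2)%:E.
Proof.
move=> v_gt0; rewrite /lower_objective; case: ifPn => [/existsP[i]|_].
  by rewrite mxE sqrf_eq0 gt_eqF.
congr (_ ^+ 2)%:E; apply: eq_bigr => i _.
by rewrite mxE sqrtr_sqr gtr0_norm.
Qed.

Lemma G_objective_lty (t a : 'rV[R]_N) (v : 'rV[R]_N.+1)
    (theta : 'M[R]_(d, n)) : (forall i, 0 <= v 0 i) ->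
  (G_objective D (t, v, a, theta) < +oo)%E ->
  forall i : 'I_N, 0 < v 0 (lo i).
Proof.
move=> v_ge0; rewrite /G_objective; case: ifPn => // /existsPn v_neq0 _ i.
by rewrite lt_neqAle eq_sym v_neq0 v_ge0.
Qed.

Lemma lower_objective_lty (x : 'rV[R]_N.+1) : (forall i, 0 <= x 0 i) ->
  (lower_objective D x < +oo)%E -> forall i : 'I_N, 0 < x 0 (lo i).
Proof.
move=> x_ge0; rewrite /lower_objective; case: ifPn => // /existsPn x_neq0 _ i.
by rewrite lt_neqAle eq_sym x_neq0 x_ge0.
Qed.

Lemma exists_profile_feasible (theta : 'M[R]_(d, n)) :
  path_feasible D theta -> exists v, profile_feasible (v, theta).
Proof.
move=> path_theta.
have Hv : \forall x \near (0 : R)^'+, forall i j, - vmin D j ^+ 2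
    <= Num.sg (q1 D theta i 0 j) * q1 D theta i 0 j ^+ 2 * x <= vmax D j ^+ 2.
  apply: filter_forall => i; apply: filter_forall => j; apply: near0_mul_itv.
  case/andP: (v_limits j) => v_lt0 v_gt0.
  by rewrite oppr_lt0 !exprn_even_gt0//= (lt_eqF v_lt0) (gt_eqF v_gt0).
have Ha : \forall x \near (0 : R)^'+, forall (i : 'I_N) j,
    amin D j <= q2 D theta (lo i) 0 j * x <= amax D j.
  apply: filter_forall => i; apply: filter_forall => j.
  exact: near0_mul_itv.
(* Here [x] is a constant squared speed, small enough for all of the finitely many constraints at
   once. *)
have [x [x_gt0 [{}Hv {}Ha]]] :=
  filter_ex (filterI (nbhs_right_gt 0) (filterI Hv Ha)).
exists (const_mx (Num.sqrt x)).
have Ex i : squared_speeds (const_mx (Num.sqrt x)) 0 i = x.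
  by rewrite !mxE sqr_sqrtr// ltW.
split=> // [i|i|]; rewrite ?mxE ?sqrtr_ge0 ?sqrtr_gt0//.
split=> [i|i j|i j]; rewrite !Ex ?(ltW x_gt0)//.
(* At constant speed the two terms in [q1] cancel, leaving [q2] times [x]. *)
by rewrite -mulrDl subrK.
Qed.

(** * Optimal solutions of (G) and (B) as optimal profiles *)

Lemma G_optimalE (z : @G_var R N n d) :
  G_optimal D z <-> exists2 y, profile_optimal y & z = motion_of y.
Proof.
split.
- case: z => [[[t v] a] theta] [z_feas z_min].
  have [[_ v_ge0 path_theta] _] := z_feas.
  have G_feas y' : profile_feasible y' ->
      G_feasible D (motion_of y') /\
      G_objective D (motion_of y') = (duration y'.1)%:E.
    case: y' => v' theta' y'_feas; have [_ _ v'_gt0 _] := y'_feas.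
    split; last exact: G_objective_duration.
    exact/G_feasible_motion_of.
  (* A slow profile for the same [theta] has finite cost, so the minimizer has finite cost too. *)
  have v_gt0 : forall i : 'I_N, 0 < v 0 (lo i).
    have [v' /G_feas[z'_feas Ez']] := exists_profile_feasible path_theta.
    apply: (G_objective_lty (t := t) (a := a) (theta := theta)) => //.
    by rewrite (le_lt_trans (z_min _ z'_feas))// Ez' ltry.
  have [Ez y_feas] := (G_feasible_motion_of t a theta v_gt0).1 z_feas.
  exists (v, theta) => //; split=> // y' /G_feas[z'_feas Ez'].
  by have := z_min _ z'_feas; rewrite Ez' G_objective_duration// lee_fin.
- case=> -[v theta] [y_feas y_min] ->.
  have [path_theta v_ge0 v_gt0 x_feas] := y_feas.
  split; first exact/G_feasible_motion_of.
  move=> [[[t' v'] a'] theta'] z'_feas; rewrite [leLHS]G_objective_duration//.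
  have [[_ v'_ge0 _] _] := z'_feas.
  (* A competitor of infinite cost is harmless; any other has positive speeds and hence comes from a
     feasible profile. *)
  have [->|] := eqVneq (G_objective D (t', v', a', theta')) +oo%E.
    by rewrite leey.
  rewrite -ltey => /(G_objective_lty v'_ge0) v'_gt0.
  rewrite G_objective_duration// lee_fin.
  exact: (y_min _ ((G_feasible_motion_of _ _ _ v'_gt0).1 z'_feas).2).
Qed.

(** When the cost is finite, the square roots of [x] form a feasible profile, and squaring preserves
    the order of nonnegative durations. *)
Lemma duration_le_lower_objective (b : R) (theta : 'M[R]_(d, n))
    (x : 'rV[R]_N.+1) : 0 <= b ->
  (forall v, profile_feasible (v, theta) -> b <= duration v) ->
  path_feasible D theta -> lower_feasible D theta x ->
  ((b ^+ 2)%:E <= lower_objective D x)%E.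
Proof.
move=> b_ge0 b_le path_theta x_feas; have [x_ge0 _ _] := x_feas.
have [->|] := eqVneq (lower_objective D x) +oo%E; first by rewrite leey.
rewrite -ltey => /(lower_objective_lty x_ge0) x_gt0.
pose v : 'rV[R]_N.+1 := \row_i Num.sqrt (x 0 i).
have v_ge0 i : 0 <= v 0 i by rewrite mxE sqrtr_ge0.
have v_gt0 (i : 'I_N) : 0 < v 0 (lo i) by rewrite mxE sqrtr_gt0.
have Ex : x = squared_speeds v by apply/rowP => i; rewrite !mxE sqr_sqrtr.
rewrite Ex lower_objective_duration// lee_fin ler_sqr ?nnegrE ?duration_ge0//.
by apply: b_le; split=> //; rewrite -Ex.
Qed.

Lemma B_optimalE : B_optimal D = profile_optimal.
Proof.
apply/seteqP; split=> -[v theta].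
- move=> [[path_theta theta_min] v_ge0 [x_feas x_min]].
  have v_gt0 : forall i : 'I_N, 0 < v 0 (lo i).
    have [v' [_ _ v'_gt0 x'_feas]] := exists_profile_feasible path_theta.
    have x_lty : (lower_objective D (squared_speeds v) < +oo)%E.
      by rewrite (le_lt_trans (x_min _ x'_feas))// lower_objective_duration// ltry.
    case: x_feas => x_ge0 _ _ i.
    have := lower_objective_lty x_ge0 x_lty i.
    by rewrite mxE exprn_even_gt0//= => v_neq0; rewrite lt_neqAle eq_sym v_neq0 v_ge0.
  split=> // -[v' theta'] [path_theta' v'_ge0 v'_gt0 x'_feas] /=.
  rewrite -ler_sqr ?nnegrE ?duration_ge0// -lee_fin -!lower_objective_duration//.
  (* The infimum is attained at [v], so optimality of [theta] can be compared with any profile over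
     any [theta']. *)
  have V_ge : (lower_objective D (squared_speeds v) <= V D theta)%E.
    by apply: le_ereal_inf_tmp => _ [x' Hx' <-]; exact: x_min.
  rewrite (le_trans V_ge)// (le_trans (theta_min _ path_theta'))//.
  by apply: ereal_inf_lbound; exists (squared_speeds v').
- move=> [[path_theta v_ge0 v_gt0 x_feas] y_min].
  (* This bound, uniform in [theta'], settles both levels: [theta' = theta] gives the lower one, and
     infima over [x] give the upper one. *)
  have x_min theta' x : path_feasible D theta' -> lower_feasible D theta' x ->
      (lower_objective D (squared_speeds v) <= lower_objective D x)%E.
    move=> path_theta' x'_feas; rewrite lower_objective_duration//.
    apply: (duration_le_lower_objective (theta := theta')) => //.
      exact: duration_ge0.
    by move=> v' /y_min.
  split=> //; last by split=> // x'; exact: x_min.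
  split=> // theta' path_theta'.
  apply: le_ereal_inf_tmp => _ [x' x'_feas <-].
  apply: (@le_trans _ _ (lower_objective D (squared_speeds v))); last first.
    exact: x_min x'_feas.
  by apply: ereal_inf_lbound; exists (squared_speeds v).
Qed.

End SpeedProfiles.

Theorem proposition2 (R : realType) (N n m d : nat) (D : path_data R N n m d)
  (N_gt0 : (0 < N)%N) (m_gt0 : (0 < m)%N) (d_gt0 : (0 < d)%N)
  (n_gt0 : (0 < n)%N) (n_gt_m : (m < n)%N)
  (s_first : s D ord0 = 0) (s_last : s D ord_max = 1)
  (ds_gt0 : forall i, 0 < ds D i)
  (p_derivable : forall x : R, derivable (p D) x 1)
  (p_derivable2 : forall x : R, derivable (derive1 (p D)) x 1)
  (r_ge1 : 1 <= r D)
  (v_limits : forall j, vmin D j < 0 < vmax D j)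
  (a_limits : forall j, amin D j < 0 < amax D j) :
  exists f : @B_var R N n d -> @G_var R N n d,
    set_bij (B_optimal D) (G_optimal D) f.
Proof.
exists (motion_of D); rewrite B_optimalE//; split.
- by move=> y y_opt; apply/G_optimalE => //; exists y.
(* Injectivity holds because [motion_of] keeps [v] and [theta] as components. *)
- by move=> [v theta] [v' theta'] _ _ [_ -> _ ->].
- by move=> z /(G_optimalE ds_gt0 v_limits a_limits)[y y_opt ->]; exists y.
Qed.
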